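(* Let $n = 2^h - 1$ with $h \ge 2$, let $m \ge 2$, and let $T_n^m$ be the graph obtained from two disjoint copies $T_{n,1}$, $T_{n,2}$ of the full binary tree on $n$ vertices and a path $P_m$ on $m$ vertices by identifying one endpoint of $P_m$ with some vertex of $T_{n,1}$ and the other endpoint with some vertex of $T_{n,2}$ (so $T_n^m$ has $2n+m-2$ vertices). Then $$\frac{2}{(2n+m-1)\bigl(2\log_2(n+1)+m-3\bigr)} \le \lambda_2(T_n^m) \le \frac{5}{2(n-1)}.$$
   Context: All graphs are finite, simple and unweighted. A full binary tree on $n=2^h-1$ vertices is the rooted tree in which every non-leaf vertex has exactly two children and all leaves are at depth $h-1=\log_2(n+1)-1$ from the root. $P_m$ is the path graph with $m$ vertices. For a graph $G$ with adjacency matrix $A$ and diagonal degree matrix $D$, the graph Laplacian is $L_G = D - A$, with eigenvalues $0=\lambda_1 \le \lambda_2 \le \dots$; $\lambda_2(G)$ denotes the second smallest eigenvalue of $L_G$. *)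

(* Defs.v *)
From HB Require Import structures.
From mathcomp Require Import all_boot all_order all_algebra.
From mathcomp Require Import all_classical all_reals.
Set Implicit Arguments. Unset Strict Implicit. Unset Printing Implicit Defensive.
Import Order.TTheory GRing.Theory Num.Theory.
Local Open Scope ring_scope.

(* A simple graph on vertex set T is a symmetric irreflexive rel T. *)

Definition laplacian (R : nzRingType) (N : nat) (e : rel 'I_N) : 'M[R]_N :=
  \matrix_(i, j) (if i == j then (#|[set k | e i k]|)%:R else - ((e i j)%:R)).

(* Full binary tree on vertices 0..n-1 (heap indexing): j is a child of i. *)
Definition bt_child (i j : nat) : bool := (j == 2 * i + 1)%N || (j == 2 * i + 2)%N.

(* Vertex layout of T_n^m, n = 2^h - 1:
   0 .. n-1        : first copy T_{n,1}
   n .. 2n-1       : second copy T_{n,2} (vertex x of the tree is n + x)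
   2n .. 2n+m-3    : the m-2 internal vertices of the path P_m.
   The path is  u, 2n, 2n+1, ..., 2n+m-3, n+v  (m vertices), its endpoints
   being identified with u in T_{n,1} and v in T_{n,2}. *)
Definition Tnm_path (n m u v : nat) : seq nat :=
  u :: iota (2 * n) (m - 2) ++ [:: (n + v)%N].

Definition Tnm_adj (n m u v : nat) (a b : nat) : bool :=
  [|| [&& (a < n)%N, (b < n)%N & bt_child a b || bt_child b a],
      [&& (n <= a < 2 * n)%N, (n <= b < 2 * n)%N &
          bt_child (a - n) (b - n) || bt_child (b - n) (a - n)]
    | has (fun k => let p := Tnm_path n m u v in
             ((nth 0%N p k == a) && (nth 0%N p k.+1 == b)) ||
             ((nth 0%N p k == b) && (nth 0%N p k.+1 == a)))
          (iota 0 (m - 1))].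

Definition Tnm (h m : nat) (u v : 'I_(2 ^ h - 1)) : rel 'I_(2 * (2 ^ h - 1) + m - 2) :=
  fun a b => Tnm_adj (2 ^ h - 1) m u v a b.
Arguments Tnm : clear implicits.

(* Main.v *)
Require Import Defs.
From HB Require Import structures.
From mathcomp Require Import all_boot all_order all_algebra.
From mathcomp Require Import all_classical all_reals.
From mathcomp Require Import complex ring lra zify.
Import Order.TTheory GRing.Theory Num.Theory.
Local Open Scope ring_scope.

(* For the lower bound, every f on the tree T_n^m is a constant plus a sum of edge
   increments times indicators of the two sides of the edge.  An edge separates at most
   N^2/4 of the pairs of vertices and a pair is separated by at most
   D = 4(h-1) + m-1 edges, so Cauchy-Schwarz summed over all pairs gives
   4 sum f^2 <= D N f L f^T when sum f = 0, that is lambda_2 >= 4 / (D N).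
   For the upper bound, pick in each copy a subtree below the root which avoids the
   attachment vertex; the function 1 on one, -1 on the other and 0 elsewhere has
   energy 2 and squared norm n - 1.  The minimax step takes place in a unitary eigenbasis
   over R[i], where the quadratic form of a real symmetric matrix splits into its values
   at the real and imaginary parts. *)

Set Implicit Arguments.
Unset Strict Implicit.
Unset Printing Implicit Defensive.

(** * Quadratic forms of real symmetric matrices and minimax for the second eigenvalue *)

Definition qform (R : nzRingType) (N : nat) (A : 'M[R]_N) (f : 'rV[R]_N) : R :=
  (f *m A *m f^T) 0 0.

Lemma qformE (R : comNzRingType) (N : nat) (A : 'M[R]_N) (f : 'rV[R]_N) :
  qform A f = \sum_i \sum_j A i j * (f 0 i * f 0 j).
Proof.
rewrite /qform mxE exchange_big; apply: eq_bigr => j _ /=.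
rewrite !mxE mulr_suml; apply: eq_bigr => i _.
by rewrite mulrAC mulrC.
Qed.

Lemma qform1E (R : comNzRingType) (N : nat) (f : 'rV[R]_N) :
  qform 1%:M f = \sum_i f 0 i ^+ 2.
Proof. by rewrite /qform mulmx1 mxE; apply: eq_bigr => i _; rewrite !mxE expr2. Qed.

Section Hermitian.
Variables (R : rcfType) (N : nat).
Local Notation C := R[i].
Local Notation toC := (real_complex R).
Local Notation re := (map_mx (@complex.Re R)).
Local Notation im := (map_mx (@complex.Im R)).
Local Open Scope sesquilinear_scope.

Definition sqmod (z : C) : R := complex.Re z ^+ 2 + complex.Im z ^+ 2.

Lemma sqmod_ge0 z : 0 <= sqmod z.
Proof. by rewrite addr_ge0 ?sqr_ge0. Qed.

Lemma sqmod_eq0 z : (sqmod z == 0) = (z == 0).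
Proof. by rewrite paddr_eq0 ?sqr_ge0 // !sqrf_eq0 eq_complex. Qed.

Lemma Re_sum (I : finType) (F : I -> C) :
  complex.Re (\sum_i F i) = \sum_i complex.Re (F i).
Proof. by apply: big_morph => // -[a b] [c d]. Qed.

Definition hform (A : 'M[R]_N) (x : 'rV[C]_N) : R :=
  qform A (re x) + qform A (im x).

Lemma hformE A x : hform A x = complex.Re ((x *m map_mx toC A *m x^t*) 0 0).
Proof.
rewrite /hform !qformE mxE Re_sum exchange_big [X in _ + X]exchange_big -big_split /=.
apply: eq_bigr => j _; rewrite -big_split !mxE mulr_suml Re_sum /=.
apply: eq_bigr => i _; rewrite !mxE -mulrA.
case: (x 0 i) (x 0 j) => [a b] [c d] /=.
ring.
Qed.

(** The spectral theorem for Hermitian matrices, applied over [R[i]]; hermiticity makes the diagonal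
    real, so [d] lives in [R]. The rows of [U] are eigenvectors and [y] holds coordinates in that
    basis. *)
Lemma symmetric_spectrum (A : 'M[R]_N) : A^T = A ->
  exists (U : 'M[C]_N) (d : 'rV[R]_N), [/\ U \is unitarymx,
    char_poly A = \prod_i ('X - (d 0 i)%:P),
    forall y, hform A (y *m U) = \sum_i d 0 i * sqmod (y 0 i) &
    forall y, hform 1%:M (y *m U) = \sum_i sqmod (y 0 i)].
Proof.
move=> symA; set B := map_mx toC A.
have hermB : B \is hermsymmx.
  apply: realsym_hermsym; last first.
    by apply/mxOverP => i j; rewrite mxE; apply/complex_realP; exists (A i j).
  by apply/is_hermitianmxP; rewrite scale1r map_mx_id // /B map_trmx symA.
set U := spectralmx B; set D := spectral_diag B.
have uU : U \is unitarymx by exact: spectral_unitarymx.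
have UU : U *m U^t* = 1%:M by exact/unitarymxP.
pose d := re D.
have dE : D = map_mx toC d.
  apply/rowP => i; rewrite !mxE RRe_real //.
  by have /mxOverP := hermitian_spectral_diag_real hermB.
have /orthomx_spectralP BE := hermitian_normalmx hermB.
rewrite -/U -/D in BE.
have UBU : U *m B *m U^t* = diag_mx D.
  by rewrite BE invmx_unitary // !mulmxA UU mul1mx -mulmxA UU mulmx1.
exists U, d; split => //.
- apply: (@map_poly_inj _ _ toC); rewrite map_char_poly -/B.
  rewrite rmorph_prod /= BE /char_poly.
  (* Scalar matrices commute with [U], so the conjugation passes to the characteristic matrix and
     disappears in the determinant. *)
  have -> : char_poly_mx (invmx U *m diag_mx D *m U) =
      map_mx polyC (invmx U) *m char_poly_mx (diag_mx D) *m map_mx polyC U.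
    rewrite /char_poly_mx mulmxBr mulmxBl -!map_mxM; congr (_ - _).
    rewrite scalar_mxC -mulmxA -map_mxM mulVmx ?unitarymx_unit //.
    by rewrite map_mx1 mulmx1.
  rewrite !det_mulmx mulrAC -det_mulmx -map_mxM mulVmx ?unitarymx_unit //.
  rewrite map_mx1 det1 mul1r -[LHS]/(char_poly (diag_mx D)).
  rewrite char_poly_trig ?diag_mx_is_trig //; apply: eq_bigr => i _.
  by rewrite rmorphB /= map_polyX map_polyC /= dE !mxE eqxx.
- move=> y; rewrite hformE -/B trmx_mul map_mxM !mulmxA -(mulmxA y) -(mulmxA y) UBU.
  rewrite dE mxE Re_sum; apply: eq_bigr => i _.
  rewrite mul_mx_diag !mxE /sqmod; case: (y 0 i) => a b /=; ring.
- move=> y; rewrite hformE map_mx1 mulmx1 trmx_mul map_mxM !mulmxA -(mulmxA y) UU.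
  rewrite mulmx1 mxE Re_sum; apply: eq_bigr => i _.
  rewrite !mxE /sqmod; case: (y 0 i) => a b /=; ring.
Qed.

Lemma Im_sum (I : finType) (F : I -> C) :
  complex.Im (\sum_i F i) = \sum_i complex.Im (F i).
Proof. by apply: big_morph => // -[a b] [c d]. Qed.

Lemma re_mulmx p (x : 'rV[C]_N) (M : 'M[R]_(N, p)) :
  re (x *m map_mx toC M) = re x *m M.
Proof.
apply/matrixP => i j; rewrite !mxE Re_sum; apply: eq_bigr => k _.
by rewrite !mxE; case: (x i k) => a b /=; ring.
Qed.

Lemma im_mulmx p (x : 'rV[C]_N) (M : 'M[R]_(N, p)) :
  im (x *m map_mx toC M) = im x *m M.
Proof.
apply/matrixP => i j; rewrite !mxE Im_sum; apply: eq_bigr => k _.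
by rewrite !mxE; case: (x i k) => a b /=; ring.
Qed.

(** Meant for [a] and [b] the values of a linear form on two vectors spanning a plane: the form
    kills a nontrivial combination of them. *)
Lemma linear_relation (F : fieldType) (a b : F) :
  exists s t, (s != 0) || (t != 0) /\ s * a + t * b = 0.
Proof.
have [->|a0] := eqVneq a 0.
  by exists 1, 0; rewrite oner_eq0 mulr0 mul0r addr0.
by exists b, (- a); rewrite oppr_eq0 a0 orbT mulNr mulrC subrr.
Qed.

Lemma qform1_ge0 (f : 'rV[R]_N) : 0 <= qform 1%:M f.
Proof. by rewrite qform1E sumr_ge0 // => i _; exact: sqr_ge0. Qed.

Lemma qform1_eq0 (f : 'rV[R]_N) : (qform 1%:M f == 0) = (f == 0).
Proof.
rewrite qform1E psumr_eq0 => [|i _]; last exact: sqr_ge0.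
apply/allP/eqP => [f0|-> i _]; last by rewrite mxE expr0n /= eqxx.
apply/rowP => i; rewrite mxE; apply/eqP; rewrite -sqrf_eq0.
exact: f0 (mem_index_enum i).
Qed.

(** As [w] is real, orthogonality to it passes to the real and imaginary parts of [x]. *)
Lemma hform_ge (A : 'M[R]_N) (w : 'rV[R]_N) (c : R) (x : 'rV[C]_N) :
  (forall f, f *m w^T = 0 -> c * qform 1%:M f <= qform A f) ->
  x *m map_mx toC w^T = 0 -> c * hform 1%:M x <= hform A x.
Proof.
move=> Ac xw; rewrite /hform mulrDr lerD // Ac //.
- by rewrite -re_mulmx xw; apply/matrixP => i j; rewrite !mxE.
- by rewrite -im_mulmx xw; apply/matrixP => i j; rewrite !mxE.
Qed.

(** Every term containing [w] vanishes; symmetry of [A] disposes of the cross term with [w] on the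
    left. *)
Lemma qform_comb (A : 'M[R]_N) (w g : 'rV[R]_N) (a b : R) :
  A^T = A -> w *m A *m w^T = 0 -> g *m A *m w^T = 0 ->
  qform A (a *: w + b *: g) = b ^+ 2 * qform A g.
Proof.
move=> symA w0 g0; have w0' : w *m A *m g^T = 0.
  by apply: trmx_inj; rewrite !trmx_mul trmxK symA mulmxA g0 trmx0.
rewrite /qform linearD /= !linearZ /= !(mulmxDl, mulmxDr).
rewrite -!scalemxAr -!scalemxAl w0 g0 w0' !scaler0 !add0r.
by rewrite scalerA mxE expr2.
Qed.

(** Courant-Fischer in counting form: at most one eigenvalue lies below [c] and at least two are at
    most [C0], which locates the entry of index 1 in the sorted list. *)
Lemma second_eigenvalue_bounds (A : 'M[R]_N) (w g : 'rV[R]_N) (c C0 : R) :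
  A^T = A -> w *m A = 0 -> g *m w^T = 0 -> w != 0 -> g != 0 -> 0 <= C0 ->
  (forall f, f *m w^T = 0 -> c * qform 1%:M f <= qform A f) ->
  qform A g <= C0 * qform 1%:M g ->
  exists s : seq R, [/\ sorted <=%R s,
    char_poly A = \prod_(x <- s) ('X - x%:P), c <= s`_1 & s`_1 <= C0].
Proof.
move=> symA wA gw w0 g0 C00 Ac Ag.
have [U [d [uU chA hA h1]]] := symmetric_spectrum symA.
(* The plane spanned by two eigenvectors meets the orthogonal complement of w. *)
have low i j : i != j -> d 0 i < c -> d 0 j < c -> False.
  move=> ij di dj.
  have [s [t [st0 st]]] := linear_relation ((U *m map_mx toC w^T) i 0)
                                           ((U *m map_mx toC w^T) j 0).
  pose y : 'rV[C]_N := s *: delta_mx 0 i + t *: delta_mx 0 j.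
  have /(hform_ge Ac) : y *m U *m map_mx toC w^T = 0.
    rewrite -mulmxA mulmxDl -!scalemxAl -!rowE.
    by apply/matrixP => p q; rewrite !ord1 [RHS]mxE -[RHS]st !mxE.
  have yi : y 0 i = s by rewrite !mxE !eqxx (negbTE ij) mulr1 mulr0 addr0.
  have yj : y 0 j = t by rewrite !mxE !eqxx eq_sym (negbTE ij) mulr1 mulr0 add0r.
  have yk k : k != i -> k != j -> y 0 k = 0.
    by move=> /negbTE ki /negbTE kj; rewrite !mxE ki kj !mulr0 addr0.
  rewrite hA h1; apply/negP; rewrite -ltNge mulr_sumr.
  rewrite (bigD1 i) //= [ltRHS](bigD1 i) //= (bigD1 j) 1?eq_sym //=.
  rewrite [in ltRHS](bigD1 j) 1?eq_sym //= yi yj.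
  rewrite big1 => [|k /andP[ki kj]]; last first.
    by rewrite yk // /sqmod expr0n /= addr0 mulr0.
  rewrite [in ltRHS]big1 => [|k /andP[ki kj]]; last first.
    by rewrite yk // /sqmod expr0n /= addr0 mulr0.
  have := sqmod_ge0 s; have := sqmod_ge0 t.
  move: st0; rewrite -!sqmod_eq0 => st0 t0 s0.
  have : 0 < sqmod s \/ 0 < sqmod t.
    by case/orP: st0 => ?; [left|right]; rewrite lt_def; apply/andP.
  by case=> ?; nra.
(* The plane spanned by w and g meets the orthogonal complement of eigenvector k0. *)
have upp k0 : (forall k, k != k0 -> C0 < d 0 k) -> False.
  move=> dk.
  have [s [t [st0 st]]] :=
    linear_relation ((map_mx toC w *m U^t*) 0 k0)
                    ((map_mx toC g *m U^t*) 0 k0).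
  pose x := s *: map_mx toC w + t *: map_mx toC g.
  pose y := x *m U^t*.
  have yU : y *m U = x.
    rewrite -mulmxA; have /unitarymxP/mulmx1C -> := uU.
    by rewrite mulmx1.
  have yk0 : y 0 k0 = 0.
    by rewrite -[RHS]st /y mulmxDl -!scalemxAl mxE [X in X + _]mxE [X in _ + X]mxE.
  have rex : re x = complex.Re s *: w + complex.Re t *: g.
    by apply/rowP => i; rewrite !mxE; case: s t {st0 st x y yU yk0} => [? ?] [? ?] /=; ring.
  have imx : im x = complex.Im s *: w + complex.Im t *: g.
    by apply/rowP => i; rewrite !mxE; case: s t {st0 st x y yU yk0 rex} => [? ?] [? ?] /=; ring.
  have wAw : w *m A *m w^T = 0 by rewrite wA mul0mx.
  have gAw : g *m A *m w^T = 0.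
    by rewrite -mulmxA -[A]symA -trmx_mul wA trmx0 mulmx0.
  have wg : w *m g^T = 0.
    by apply: trmx_inj; rewrite trmx_mul trmxK gw trmx0.
  have q1 a b : qform 1%:M (a *: w + b *: g) =
      a ^+ 2 * qform 1%:M w + b ^+ 2 * qform 1%:M g.
    rewrite /qform !mulmx1 linearD /= !linearZ /= !(mulmxDl, mulmxDr).
    rewrite -!scalemxAr -!scalemxAl gw wg !scaler0 addr0 add0r.
    by rewrite !scalerA mxE [X in X + _]mxE [X in _ + X]mxE !expr2.
  have hAx : hform A (y *m U) = sqmod t * qform A g.
    by rewrite yU /hform rex imx !qform_comb // -mulrDl.
  have h1x : hform 1%:M (y *m U) =
      sqmod s * qform 1%:M w + sqmod t * qform 1%:M g.
    by rewrite yU /hform rex imx !q1 /sqmod; ring.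
  have w1 : 0 < qform 1%:M w by rewrite lt_def qform1_eq0 w0 qform1_ge0.
  have g1 : 0 < qform 1%:M g by rewrite lt_def qform1_eq0 g0 qform1_ge0.
  have s0 := sqmod_ge0 s; have t0 := sqmod_ge0 t.
  have pos : 0 < hform 1%:M (y *m U).
    rewrite h1x; case/orP: st0; rewrite -sqmod_eq0 => n0.
      by rewrite ltr_pwDl ?mulr_ge0 ?mulr_gt0 ?(ltW g1) // lt_def n0.
    by rewrite ltr_wpDl ?mulr_ge0 ?mulr_gt0 ?(ltW w1) // lt_def n0.
  (* The [w] component adds no energy and only enlarges the right side, as [C0] is nonnegative. *)
  have le1 : hform A (y *m U) <= C0 * hform 1%:M (y *m U).
    rewrite hAx h1x mulrDr ler_wpDl ?mulr_ge0 ?(ltW w1) //.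
    by rewrite mulrCA ler_wpM2l.
  move: le1 pos; rewrite hA h1 mulr_sumr => le1.
  have le2 i : 0 <= d 0 i * sqmod (y 0 i) - C0 * sqmod (y 0 i).
    rewrite -mulrBl; have [->|ik] := eqVneq i k0.
      by rewrite yk0 /sqmod expr0n addr0 mulr0.
    by rewrite mulr_ge0 ?sqmod_ge0 // subr_ge0 ltW ?dk.
  (* Nonnegative terms with a nonpositive sum all vanish; off [k0] this forces [y] to vanish,
     against [pos]. *)
  have /eqP : \sum_i (d 0 i * sqmod (y 0 i) - C0 * sqmod (y 0 i)) = 0.
    apply/eqP; rewrite eq_le sumr_ge0 // andbT.
    by rewrite sumrB subr_le0.
  rewrite psumr_eq0 // => /allP z; rewrite big1 ?ltxx // => i _.
  have := z i (mem_index_enum i); rewrite -mulrBl mulf_eq0.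
  have [->|ik] := eqVneq i k0; first by rewrite yk0 /sqmod expr0n addr0.
  by rewrite gt_eqF ?subr_gt0 ?dk //= => /eqP.
pose s := sort <=%R [seq d 0 i | i <- enum 'I_N].
have ss : sorted <=%R s by apply: sort_sorted; exact: le_total.
have cnt P : count P s = #|[pred i | P (d 0 i)]|.
  rewrite (permP (permEl (perm_sort _ _))) count_map.
  by rewrite -size_filter /= cardE /enum_mem -filter_predI;
     congr (size _); apply: eq_filter => i; rewrite /= !inE andbT.
(* Otherwise [upp] applies to the only index with eigenvalue at most [C0], or to any index if there
   is none; [g != 0] ensures that an index exists. *)
have c2 : (1 < count (<= C0) s)%N.
  rewrite cnt ltnNge; apply/negP => le1.
  case: (pickP [pred i | d 0 i <= C0]) => [k0 /= dk0|none].
    apply: (upp k0) => k kk0; rewrite ltNge; apply/negP => dk.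
    move/card_le1_eqP: le1 => /(_ k k0); rewrite !inE => /(_ dk dk0) kE.
    by rewrite kE eqxx in kk0.
  have gN : (0 < N)%N.
    rewrite lt0n; apply: contra_neq g0 => N0; apply/rowP => -[i iN].
    by exfalso; move: (iN); rewrite N0 ltn0.
  apply: (upp (Ordinal gN)) => k _; rewrite ltNge.
  by have := none k; rewrite /= => ->.
have c1 : (count (< c) s <= 1)%N.
  rewrite cnt; apply/card_le1_eqP => i j; rewrite !inE => di dj.
  by apply/eqP; apply/negPn/negP => ij; exact: (low j i ij dj di).
exists s; split => //.
- rewrite chA -(big_enum _ _ _ (fun i => 'X - (d 0 i)%:P)) /=.
  rewrite -(big_map (d 0) xpredT (fun a => 'X - a%:P)).
  by apply: perm_big; rewrite perm_sym perm_sort.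
(* By [c2] the list has at least two entries, so the default value 0 of the lookup is never read. *)
- move: ss c1 c2; case: (s) => [|x0 [|x1 s']] //=.
    by case: (x0 <= C0).
  move=> /andP[x01 _] c1 _; rewrite leNgt; apply/negP => x1c.
  by move: c1; rewrite x1c (le_lt_trans x01 x1c).
- move: ss c2; case: (s) => [|x0 [|x1 s']] //=.
  move=> /andP[x01 ps] c2; rewrite leNgt; apply/negP => x1c.
  move: c2; rewrite (lt_geF x1c).
  rewrite (_ : count _ s' = 0%N); first by case: (x0 <= C0).
  apply/eqP; rewrite -leqn0 leqNgt -has_count; apply/hasPn => z zs.
  have /allP/(_ z zs) x1z := order_path_min le_trans ps.
  by rewrite -ltNge (lt_le_trans x1c x1z).
Qed.

End Hermitian.

(** * The graph Laplacian and its energy *)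

Section Laplacian.
Variables (R : comNzRingType) (N : nat) (e : rel 'I_N).
Hypotheses (sym_e : symmetric e) (irr_e : irreflexive e).

Lemma laplacianE i j :
  laplacian R e i j = (i == j)%:R * (\sum_k (e i k)%:R) - (e i j)%:R.
Proof.
rewrite mxE; have [->|ij] := eqVneq i j; last by rewrite mul0r sub0r.
rewrite irr_e subr0 mul1r -natr_sum -sum1_card big_mkcond /=.
by congr _%:R; apply: eq_bigr => k _; rewrite inE; case: e.
Qed.

Lemma tr_laplacian : (laplacian R e)^T = laplacian R e.
Proof.
apply/matrixP => i j; rewrite mxE !laplacianE sym_e eq_sym.
by have [->|] := eqVneq i j; rewrite ?mul0r.
Qed.

Lemma const_mul_laplacian : const_mx 1 *m laplacian R e = 0 :> 'rV_N.
Proof.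
apply/rowP => j; rewrite !mxE.
under eq_bigr => i _ do rewrite mxE mul1r laplacianE.
rewrite sumrB (bigD1 j) //= eqxx mul1r [X in _ + X - _]big1 ?addr0; last first.
  by move=> i /negbTE ->; rewrite mul0r.
by apply/eqP; rewrite subr_eq0; apply/eqP/eq_bigr => i _; rewrite sym_e.
Qed.

(** Ordered pairs count each edge twice; doubling the left side avoids a division in [R]. *)
Lemma qform_laplacian (f : 'rV[R]_N) : qform (laplacian R e) f *+ 2 =
  \sum_i \sum_j (e i j)%:R * (f 0 j - f 0 i) ^+ 2.
Proof.
have deg : \sum_i \sum_j (e i j)%:R * f 0 i ^+ 2 =
           \sum_i \sum_j (e i j)%:R * f 0 j ^+ 2.
  rewrite exchange_big; apply: eq_bigr => i _; apply: eq_bigr => j _.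
  by rewrite sym_e.
have -> : \sum_i \sum_j (e i j)%:R * (f 0 j - f 0 i) ^+ 2 =
  \sum_i \sum_j (e i j)%:R * f 0 i ^+ 2 + \sum_i \sum_j (e i j)%:R * f 0 j ^+ 2
  - (\sum_i \sum_j (e i j)%:R * (f 0 i * f 0 j)) *+ 2.
  rewrite -sumrMnl -big_split -sumrB; apply: eq_bigr => i _ /=.
  rewrite -sumrMnl -big_split -sumrB; apply: eq_bigr => j _ /=.
  ring.
rewrite -deg -mulr2n -mulrnBl qformE; congr (_ *+ 2).
rewrite -sumrB; apply: eq_bigr => i _.
under eq_bigr => j _ do rewrite laplacianE mulrBl.
rewrite sumrB; congr (_ - _); rewrite (bigD1 i) //= eqxx mul1r [X in _ + X]big1 ?addr0.
  by rewrite mulr_suml; apply: eq_bigr => j _; rewrite expr2.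
by move=> j /negbTE ji; rewrite eq_sym ji !mul0r.
Qed.

End Laplacian.

Section Energy.
Variables (R : realFieldType) (N : nat) (e : rel 'I_N).
Hypotheses (sym_e : symmetric e) (irr_e : irreflexive e).

(** The listed edges, taken in both orientations, embed into the ordered pairs of [qform_laplacian];
    the remaining pairs contribute nonnegative terms. *)
Lemma energy_ge (I : finType) (a b : I -> 'I_N) (f : 'rV[R]_N) :
  (forall i, e (a i) (b i)) ->
  injective (fun p : I * bool => if p.2 then (a p.1, b p.1) else (b p.1, a p.1)) ->
  \sum_i (f 0 (b i) - f 0 (a i)) ^+ 2 <= qform (laplacian R e) f.
Proof.
move=> eab; set phi := (phi in injective phi) => phiI.
rewrite -(@ler_pMn2r _ 2) // qform_laplacian // pair_big /=.
have -> : (\sum_i (f 0 (b i) - f 0 (a i)) ^+ 2) *+ 2 =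
    \sum_(q in phi @: predT) (e q.1 q.2)%:R * (f 0 q.2 - f 0 q.1) ^+ 2.
  rewrite big_imset /=; last by move=> ? ? _ _; exact: phiI.
  rewrite -(pair_big xpredT xpredT (fun i c => (e (phi (i, c)).1 (phi (i, c)).2)%:R *
      (f 0 (phi (i, c)).2 - f 0 (phi (i, c)).1) ^+ 2)) /=.
  rewrite -sumrMnl; apply: eq_bigr => i _.
  by rewrite big_bool /= eab sym_e eab !mul1r; ring.
rewrite [leRHS](bigID [pred q | q \in phi @: predT]) /= lerDl.
by rewrite sumr_ge0 // => q _; rewrite mulr_ge0 ?sqr_ge0.
Qed.

End Energy.

(** * A Poincaré inequality from edge cuts *)

Section Cuts.
Variable R : realFieldType.

(** Lagrange's identity. Restricted to [P] it yields Cauchy-Schwarz over the separating cuts; over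
    all vertices it counts separated pairs and evaluates the pair sum of [f]. *)
Lemma sum_sqr_diff (I : finType) (P : pred I) (a : I -> R) :
  \sum_(i | P i) \sum_(j | P j) (a i - a j) ^+ 2 =
  ((\sum_i P i)%:R * \sum_(i | P i) a i ^+ 2 - (\sum_(i | P i) a i) ^+ 2) *+ 2.
Proof.
have cst (x : R) : \sum_(i | P i) x = (\sum_i P i)%:R * x.
  rewrite sumr_const mulr_natl -sum1_card big_mkcond /=.
  by congr (_ *+ _); apply: eq_bigr => i _; rewrite unfold_in; case: (P i).
set A := \sum_(i | P i) a i; set Q := \sum_(i | P i) a i ^+ 2.
transitivity (\sum_(i | P i)
    ((\sum_i P i)%:R * a i ^+ 2 + Q - (a i *+ 2) * A)).
  apply: eq_bigr => i _; rewrite -cst mulr_sumr -big_split -sumrB /=.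
  by apply: eq_bigr => j _; ring.
rewrite sumrB big_split /= cst -mulr_sumr -mulr_suml sumrMnl -/Q -/A.
by ring.
Qed.

Lemma sum_sqr_le (I : finType) (P : pred I) (a : I -> R) :
  (\sum_(i | P i) a i) ^+ 2 <= (\sum_i P i)%:R * \sum_(i | P i) a i ^+ 2.
Proof.
rewrite -subr_ge0 -(@pmulrn_lge0 _ _ 2) // -sum_sqr_diff.
by rewrite sumr_ge0 // => i _; rewrite sumr_ge0 // => j _; exact: sqr_ge0.
Qed.

(* Each cut [S i] separates at most |V|^2 / 4 unordered pairs, and any pair is
   separated by at most D cuts; summing Cauchy-Schwarz over all pairs gives the bound. *)
Lemma cut_poincare (V I : finType) (S : I -> pred V) (dl : I -> R) (f : V -> R)
    (K : R) (D : nat) :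
  (forall x, f x = K + \sum_i dl i * (S i x)%:R) ->
  (forall x y, (\sum_i (S i x != S i y) <= D)%N) ->
  \sum_x f x = 0 ->
  4 * \sum_x f x ^+ 2 <= D%:R * #|V|%:R * \sum_i dl i ^+ 2.
Proof.
move=> fE SD f0.
have [V0|V0] := posnP #|V|.
  rewrite V0 mulr0 mul0r big1 ?mulr0 // => x _.
  by have := card0_eq V0 x; rewrite inE.
(* Only the cuts separating [x] from [y] contribute to the difference, and there are at most [D] of
   them. *)
have cs x y : (f x - f y) ^+ 2 <=
    D%:R * \sum_i (S i x != S i y)%:R * dl i ^+ 2.
  have -> : f x - f y =
      \sum_(i | S i x != S i y) dl i * ((S i x)%:R - (S i y)%:R).
    rewrite !fE opprD addrACA subrr add0r -sumrB [RHS]big_mkcond /=.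
    apply: eq_bigr => i _; rewrite -mulrBr.
    by have [->|] := eqVneq (S i x) (S i y); rewrite // subrr mulr0.
  apply: le_trans (sum_sqr_le _ _) _.
  have -> : \sum_(i | S i x != S i y) (dl i * ((S i x)%:R - (S i y)%:R)) ^+ 2 =
      \sum_i (S i x != S i y)%:R * dl i ^+ 2.
    rewrite big_mkcond; apply: eq_bigr => i _; rewrite exprMn.
    by case: (S i x) (S i y) => [] [] /=; ring.
  rewrite ler_wpM2r ?ler_nat ?SD //.
  by rewrite sumr_ge0 // => i _; rewrite mulr_ge0 ?sqr_ge0.
(* Ordered pairs: a side with s vertices gives 2 s (|V| - s), at most |V|^2 / 2. *)
have cut i : \sum_x \sum_y (S i x != S i y)%:R <= #|V|%:R ^+ 2 / 2 :> R.
  pose s : R := \sum_x (S i x)%:R.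
  have -> : \sum_x \sum_y (S i x != S i y)%:R = (#|V|%:R * s - s ^+ 2) *+ 2.
    have -> : #|V| = (\sum_(x : V) true)%N by rewrite sum1_card.
    rewrite [X in _ * X - _](_ : s = \sum_x (S i x)%:R ^+ 2); last first.
      by apply: eq_bigr => x _; case: (S i x); rewrite ?expr1n ?expr0n.
    rewrite -sum_sqr_diff.
    apply: eq_bigr => x _; apply: eq_bigr => y _.
    by case: (S i x) (S i y) => [] [] /=; ring.
  have := sqr_ge0 (#|V|%:R - s *+ 2); nra.
have dist : \sum_x \sum_y (f x - f y) ^+ 2 =
    (#|V|%:R * \sum_x f x ^+ 2) *+ 2.
  by rewrite sum_sqr_diff f0 expr0n subr0 sum1_card.
have le : \sum_x \sum_y (f x - f y) ^+ 2 <=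
    D%:R * \sum_i dl i ^+ 2 * (#|V|%:R ^+ 2 / 2).
  apply: (@le_trans _ _ (\sum_x \sum_y (D%:R * \sum_i (S i x != S i y)%:R * dl i ^+ 2))).
    by apply: ler_sum => x _; apply: ler_sum => y _; exact: cs.
  under eq_bigr => x _ do rewrite -mulr_sumr exchange_big /=.
  rewrite -mulr_sumr exchange_big /= ler_wpM2l //.
  apply: ler_sum => i _.
  under eq_bigr => x _ do rewrite -mulr_suml.
  by rewrite -mulr_suml mulrC ler_wpM2l ?sqr_ge0.
move: le; rewrite dist -mulr_suml => le.
have Vp : (0 : R) < #|V|%:R by rewrite ltr0n.
rewrite -(ler_pM2l Vp); nra.
Qed.

End Cuts.

(** * Root paths and subtrees in the heap-indexed binary tree *)

(* Heap indexing makes i./2 the parent of vertex i.+1, so an index i stands both for the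
   non-root vertex i.+1 and for the tree edge above it.  [ancestors k z] lists the edges
   on the way from z to the root; the fuel k bounds the depth of z. *)
Fixpoint ancestors (k z : nat) : seq nat :=
  match k, z with
  | k'.+1, z'.+1 => z' :: ancestors k' z'./2
  | _, _ => [::]
  end.

Lemma ancestors_lt k z i : i \in ancestors k z -> (i < z)%N.
Proof.
elim: k z => [|k IHk] [|z] //=; rewrite inE => /orP[/eqP -> //|/IHk lt_i].
by apply: leq_trans lt_i _; lia.
Qed.

Lemma ancestors_uniq k z : uniq (ancestors k z).
Proof.
elim: k z => [|k IHk] [|z] //=; rewrite IHk andbT.
by apply/negP => /ancestors_lt; lia.
Qed.

Lemma size_ancestors k z : (size (ancestors k z) <= k)%N.
Proof. by elim: k z => [|k IHk] [|z] //=; rewrite ltnS. Qed.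

(** The bound says that [z] has depth at most [k], so the extra fuel is not consumed. *)
Lemma ancestors_stable k z : (z.+1 < 2 ^ k.+1)%N ->
  ancestors k.+1 z = ancestors k z.
Proof.
elim: k z => [|k IHk] [|z] lt_z //.
by rewrite [LHS]/= -/(ancestors k.+1 _) IHk //; move: lt_z; rewrite !expnS; lia.
Qed.

(** Indices 0 and 1 are the two edges below the root, and a path to the root ends with only one of
    them. *)
Lemma ancestors01 k z : ~~ ((0%N \in ancestors k z) && (1%N \in ancestors k z)).
Proof.
elim: k z => [|k IHk] [|[|[|z]]] //=; rewrite ?inE.
- by case: k {IHk}.
- by case: k {IHk}.
- exact: IHk.
Qed.

Lemma sum_ancestors (R : zmodType) (F : nat -> R) k z : (z.+1 < 2 ^ k.+1)%N ->
  F z = F 0 + \sum_(i <- ancestors k z) (F i.+1 - F i./2).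
Proof.
elim: k z => [|k IHk] [|z] lt_z; rewrite /= ?big_nil ?addr0 //.
have lt_z2 : (z./2.+1 < 2 ^ k.+1)%N by move: lt_z; rewrite !expnS; lia.
rewrite big_cons addrCA -(IHk _ lt_z2); apply/esym/subrK.
Qed.

Lemma big_seq_ord (R : nmodType) (G : nat -> R) M (s : seq nat) :
  uniq s -> {in s, forall i, (i < M)%N} ->
  \sum_(i <- s) G i = \sum_(i < M | (i : nat) \in s) G i.
Proof.
move=> us sM; rewrite -(big_mkord (mem s) G) /index_iota subn0 -big_filter.
apply: perm_big; apply: uniq_perm => //; first by rewrite filter_uniq ?iota_uniq.
move=> i; rewrite mem_filter mem_iota leq0n add0n inE /=.
by case: (boolP (i \in s)) => // /sM ->.
Qed.

Lemma sum_mem_le M (s : seq nat) : uniq s -> {in s, forall i, (i < M)%N} ->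
  (\sum_(i < M) ((i : nat) \in s) = size s)%N.
Proof.
move=> us sM.
rewrite -sum1_size (@big_seq_ord nat (fun=> 1%N) M s us sM) [RHS]big_mkcond /=.
by apply: eq_bigr => i _; case: (_ \in _).
Qed.

Lemma telescope_ord (R : pzRingType) (F : nat -> R) M k : (k <= M)%N ->
  F k = F 0%N + \sum_(i < M) (F i.+1 - F i) * (i < k)%N%:R.
Proof.
move=> kM; have -> : \sum_(i < M) (F i.+1 - F i) * (i < k)%N%:R =
    \sum_(i < M | (i < k)%N) (F i.+1 - F i).
  by rewrite [RHS]big_mkcond; apply: eq_bigr => i _; case: ltnP; rewrite ?mulr1 ?mulr0.
rewrite -(big_ord_widen M (fun i => F i.+1 - F i) kM).
by rewrite -(big_mkord xpredT (fun i => F i.+1 - F i)) telescope_sumr // addrC subrK.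
Qed.

Lemma sum_half G M : (\sum_(z < M.*2) G z./2 = (\sum_(z < M) G z).*2)%N.
Proof.
elim: M => [|M IHM]; first by rewrite !big_ord0.
rewrite doubleS !big_ord_recr /= IHM; rewrite doubleD -addnn.
by rewrite uphalf_double half_double; lia.
Qed.

(** Induction on the height: a non-root vertex lies below edge [c] when it is the lower end of [c]
    or its parent lies below [c], never both, and each parent has two children. *)
Lemma subtree_size k c : (c <= 1)%N ->
  (\sum_(z < 2 ^ k.+1 - 1) ((c \in ancestors k z) : nat) = 2 ^ k - 1)%N.
Proof.
move=> c1; elim: k => [|k IHk]; first by rewrite big1.
have -> : (2 ^ k.+2 - 1 = (2 ^ k.+1 - 1).*2.+1)%N.
  by rewrite [(2 ^ k.+2)%N]expnS; have := expn_gt0 2 k.+1; lia.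
rewrite big_ord_recl /= add0n.
transitivity (\sum_(i < (2 ^ k.+1 - 1).*2)
    (((i : nat) \in [:: c]) + (c \in ancestors k i./2)))%N.
  apply: eq_bigr => i _; rewrite /= !inE.
  have := @ancestors_lt k i./2 c; rewrite [c == _]eq_sym.
  by case: eqVneq => [ic|_] //=; case: (c \in _) => // /(_ isT); lia.
rewrite big_split /= (@sum_mem_le _ [:: c]) //; last first.
  by move=> i; rewrite inE => /eqP ->; have := expn_gt0 2 k; rewrite expnS; lia.
rewrite (sum_half (fun z => (c \in ancestors k z) : nat)) IHk /=.
by have := expn_gt0 2 k; rewrite expnS; lia.
Qed.

Lemma exists_free_subtree k z :
  exists2 c : nat, (c <= 1)%N & c \notin ancestors k z.
Proof.
have := ancestors01 k z; rewrite negb_and => /orP[]; first by exists 0%N.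
by exists 1%N.
Qed.

Definition tree_adj (a b : nat) : bool := bt_child a b || bt_child b a.

Lemma tree_adjC a b : tree_adj a b = tree_adj b a.
Proof. by rewrite /tree_adj orbC. Qed.

Lemma tree_size h : (2 ^ h = (2 ^ h - 1).+1)%N.
Proof. by have := expn_gt0 2 h; lia. Qed.

Section Tnm.
Variables (h m : nat).
Let n := (2 ^ h - 1)%N.
Local Notation N := (2 * n + m - 2)%N.
Hypothesis h_ge2 : (2 <= h)%N.

Lemma tree_size_ge3 : (3 <= n)%N.
Proof. by have := @leq_pexp2l 2 2 h isT h_ge2; rewrite /n; lia. Qed.

(** Telescoping along the root path, recast as a sum over all tree edges weighted by cut
    indicators. *)
Lemma sum_ancestors_ord (R : pzRingType) (F : nat -> R) z : (z < n)%N ->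
  F z = F 0%N + \sum_(i < n.-1) (F i.+1 - F i./2) * ((i : nat) \in ancestors h.-1 z)%:R.
Proof.
move=> zn; rewrite (@sum_ancestors _ F h.-1 z); last first.
  by rewrite prednK; [have := tree_size h; rewrite -/n; lia | lia].
rewrite (@big_seq_ord _ (fun i => F i.+1 - F i./2) n.-1) ?ancestors_uniq //; last first.
  by move=> i /ancestors_lt; lia.
congr (_ + _); rewrite big_mkcond; apply: eq_bigr => i _.
by case: (_ \in _); rewrite ?mulr1 ?mulr0.
Qed.

(** The root path of a child is that of its parent plus one edge, so membership of [c] changes only
    across edge [c] itself, whose upper end is the root because [c <= 1]. *)
Lemma subtree_edge c a b : (c <= 1)%N -> (a < n)%N -> (b < n)%N -> tree_adj a b ->
  (c \in ancestors h.-1 a) != (c \in ancestors h.-1 b) ->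
  (a == 0)%N && (b == c.+1) || (b == 0)%N && (a == c.+1).
Proof.
move=> c1; wlog ab : a b / bt_child a b.
  move=> wl an bn /orP[ab|ba]; first by apply: wl; rewrite /tree_adj ?ab.
  by rewrite eq_sym orbC; apply: wl; rewrite /tree_adj ?ba.
move=> an bn _.
case: b bn ab => [|z] bn ab; first by move: ab; rewrite /bt_child; lia.
have aE : a = z./2 by move: ab; rewrite /bt_child; lia.
have -> : ancestors h.-1 z.+1 = z :: ancestors h.-1 a.
  have hz : (z.+2 < 2 ^ h)%N by have := tree_size h; rewrite -/n; lia.
  rewrite aE; case: h h_ge2 hz => [|[|k]] // _ hz /=.
  by rewrite -/(ancestors k.+1 _) ancestors_stable //; move: hz; rewrite expnS; lia.
rewrite inE; case: (eqVneq c z) => [cz|]; last by rewrite eqxx.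
by move=> _; rewrite aE -cz eqxx andbT; apply/orP; left; lia.
Qed.

(** * Retractions, edges and cuts of T_n^m, and the lower bound *)

Variables u v : 'I_n.

(** Retractions onto the first copy, the second copy (renumbered from 0) and the path (by position):
    everything outside a piece goes to the vertex where it is attached. *)
Definition to_tree1 (x : nat) : nat := if (x < n)%N then x else u.
Definition to_tree2 (x : nat) : nat := if (n <= x < 2 * n)%N then (x - n)%N else v.
Definition to_path (x : nat) : nat :=
  if (x < n)%N then 0%N else if (x < 2 * n)%N then m.-1 else (x - 2 * n).+1.

Lemma to_tree1_lt x : (to_tree1 x < n)%N.
Proof. by rewrite /to_tree1; case: ifP => // _; exact: ltn_ord. Qed.

Lemma to_tree2_lt x : (to_tree2 x < n)%N.
Proof. by rewrite /to_tree2; case: ifP => [|_]; [lia | exact: ltn_ord]. Qed.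

Definition path_vertex (k : nat) : nat := nth 0%N (Tnm_path n m u v) k.

Lemma Tnm_adjE a b : Tnm_adj n m u v a b =
  [|| [&& (a < n)%N, (b < n)%N & tree_adj a b],
      [&& (n <= a < 2 * n)%N, (n <= b < 2 * n)%N & tree_adj (a - n) (b - n)]
    | has (fun k => (path_vertex k == a) && (path_vertex k.+1 == b) ||
                    (path_vertex k == b) && (path_vertex k.+1 == a)) (iota 0 (m - 1))].
Proof. by []. Qed.

Lemma Tnm_sym : symmetric (Tnm h m u v).
Proof.
move=> a b; rewrite /Tnm !Tnm_adjE tree_adjC [tree_adj (a - n) _]tree_adjC.
congr [|| _, _ | _]; [by rewrite andbCA | by rewrite andbCA |].
by apply: eq_has => k; rewrite orbC.
Qed.

Hypothesis m_ge2 : (2 <= m)%N.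

Lemma path_vertexE k : (k < m)%N -> path_vertex k =
  if k == 0%N then u : nat else if k == m.-1 then (n + v)%N else (2 * n + k - 1)%N.
Proof.
move=> km; rewrite /path_vertex /Tnm_path; case: k km => [|k] //= km.
rewrite nth_cat size_iota; case: ltnP => hk.
  by rewrite nth_iota // ifF; [lia|apply/negP => /eqP; lia].
have -> : k = (m - 2)%N by lia.
by rewrite subnn ifT //; apply/eqP; lia.
Qed.

Lemma path_vertexP k : (k < m)%N ->
  [\/ k = 0%N /\ path_vertex k = u, k = m.-1 /\ path_vertex k = (n + v)%N |
      [/\ 0 < k, k < m.-1 & path_vertex k = (2 * n + k - 1)%N]%N].
Proof.
move=> km; rewrite path_vertexE //; case: eqVneq => [->|k0]; first by constructor 1.
by case: eqVneq => [->|k1]; [constructor 2|constructor 3; split; lia].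
Qed.

Lemma Tnm_irr : irreflexive (Tnm h m u v).
Proof.
move=> a; rewrite /Tnm Tnm_adjE /tree_adj !orbb; apply/negP => /or3P[].
- by move=> /and3P[_ _]; rewrite /bt_child; lia.
- by move=> /and3P[_ _]; rewrite /bt_child; lia.
move=> /hasP[k]; rewrite mem_iota orbb => km.
have /path_vertexP hk : (k < m)%N by lia.
have /path_vertexP hk1 : (k.+1 < m)%N by lia.
have := ltn_ord u; have := ltn_ord v.
by case: hk => -[]; case: hk1 => -[]; lia.
Qed.

(** Tree edges are numbered by their lower end minus one, path edges by the position of their end
    nearer to [u]. *)
Local Notation tree_edge := ('I_n.-1 + 'I_n.-1 + 'I_m.-1)%type.

Definition edge_head (i : tree_edge) : nat :=
  match i with
  | inl (inl j) => j./2
  | inl (inr j) => n + j./2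
  | inr j => path_vertex j
  end.

Definition edge_tail (i : tree_edge) : nat :=
  match i with
  | inl (inl j) => j.+1
  | inl (inr j) => n + j.+1
  | inr j => path_vertex j.+1
  end.

Lemma path_vertex_lt k : (k < m)%N -> (path_vertex k < N)%N.
Proof.
have := ltn_ord u; have := ltn_ord v; have := tree_size_ge3.
by move=> ? ? ? /path_vertexP; case=> -[]; lia.
Qed.

Lemma edge_head_lt i : (edge_head i < N)%N.
Proof.
have n3 := tree_size_ge3.
case: i => [[]|] j /=; last by apply: path_vertex_lt; have := ltn_ord j; lia.
all: by have := ltn_ord j; lia.
Qed.

Lemma edge_tail_lt i : (edge_tail i < N)%N.
Proof.
have n3 := tree_size_ge3.
case: i => [[]|] j /=; last by apply: path_vertex_lt; have := ltn_ord j; lia.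
all: by have := ltn_ord j; lia.
Qed.

Lemma edge_adj i : Tnm_adj n m u v (edge_head i) (edge_tail i).
Proof.
rewrite Tnm_adjE; case: i => [[]|] j /=.
- apply/or3P; constructor 1; rewrite /tree_adj /bt_child.
  by have := ltn_ord j; lia.
- apply/or3P; constructor 2; rewrite /tree_adj /bt_child.
  by have := ltn_ord j; lia.
- apply/or3P; constructor 3; apply/hasP; exists (j : nat).
    by rewrite mem_iota; have := ltn_ord j; lia.
  by rewrite !eqxx.
Qed.

Lemma path_vertex_inj k l : (k < m)%N -> (l < m)%N ->
  path_vertex k = path_vertex l -> k = l.
Proof.
have lu := ltn_ord u; have lv := ltn_ord v.
move=> /path_vertexP hk /path_vertexP hl.
by case: hk => -[]; case: hl => -[]; lia.
Qed.

(** The ends of the path lie in different copies and its inner vertices in neither; this keeps path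
    edges apart from tree edges. *)
Lemma path_vertex_leaves_trees k : (k.+1 < m)%N ->
  ~ (path_vertex k < n /\ path_vertex k.+1 < n)%N /\
  ~ (n <= path_vertex k < 2 * n /\ n <= path_vertex k.+1 < 2 * n)%N.
Proof.
have lu := ltn_ord u; have lv := ltn_ord v.
move=> km; have /path_vertexP hk : (k < m)%N by lia.
move/path_vertexP: km => hk1.
by case: hk => -[]; case: hk1 => -[]; lia.
Qed.

Lemma edge_ends_inj i j :
  edge_head i = edge_head j -> edge_tail i = edge_tail j -> i = j.
Proof.
case: i j => [[]|] i [[]|] j /=; have li := ltn_ord i; have lj := ltn_ord j.
- by move=> _ [] /val_inj ->.
- lia.
- have [] := @path_vertex_leaves_trees j; lia.
- lia.
- by move=> _ /addnI[] /val_inj ->.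
- have [] := @path_vertex_leaves_trees j; lia.
- have [] := @path_vertex_leaves_trees i; lia.
- have [] := @path_vertex_leaves_trees i; lia.
- by move=> /path_vertex_inj ij _; congr inr; apply/val_inj/ij; lia.
Qed.

(** Together with [edge_ends_inj], this is the injectivity on oriented edges that [energy_ge] asks
    for. *)
Lemma edge_not_reversed i j :
  edge_head i = edge_tail j -> edge_tail i = edge_head j -> False.
Proof.
case: i j => [[]|] i [[]|] j /=; have li := ltn_ord i; have lj := ltn_ord j.
- lia.
- lia.
- have [] := @path_vertex_leaves_trees j; lia.
- lia.
- lia.
- have [] := @path_vertex_leaves_trees j; lia.
- have [] := @path_vertex_leaves_trees i; lia.
- have [] := @path_vertex_leaves_trees i; lia.
- move=> /path_vertex_inj ij /path_vertex_inj ji.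
  by have := ij ltac:(lia) ltac:(lia); have := ji ltac:(lia) ltac:(lia); lia.
Qed.

(* The cut of an edge has to contain one side of it in the whole of T_n^m; it is the
   preimage of the vertices below the edge (resp. further along the path) under the
   retraction of T_n^m onto the copy of the tree (resp. the path) holding the edge. *)
Definition cut (i : tree_edge) (x : nat) : bool :=
  match i with
  | inl (inl j) => (j : nat) \in ancestors h.-1 (to_tree1 x)
  | inl (inr j) => (j : nat) \in ancestors h.-1 (to_tree2 x)
  | inr j => (j < to_path x)%N
  end.

Lemma cut_decomposition (R : comPzRingType) (F : nat -> R) : exists K, forall x, (x < N)%N ->
  F x = K + \sum_i (F (edge_tail i) - F (edge_head i)) * (cut i x)%:R.
Proof.
(* The constant corrects for telescoping that starts at the roots [0] and [n] rather than at [u] and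
   [n + v]. *)
exists (F 0%N - F u + F (n + 0)%N - F (n + v)%N + F (path_vertex 0)) => x xN.
have n3 := tree_size_ge3.
have pathx : F (path_vertex (to_path x)) = F (path_vertex 0) +
    \sum_(i < m.-1) (F (path_vertex i.+1) - F (path_vertex i)) * (i < to_path x)%N%:R.
  apply: (@telescope_ord _ (fun k => F (path_vertex k))).
  by rewrite /to_path; do 2?[case: ltnP]; lia.
(* For [x] in one piece, the other two retractions land on attachment vertices, whose terms
   cancel. *)
have xE : F x = (F (to_tree1 x) - F u) + (F (n + to_tree2 x)%N - F (n + v)%N) +
    F (path_vertex (to_path x)).
  rewrite /to_tree1 /to_tree2 /to_path; have [xn|nx] := ltnP x n.
    by rewrite /= path_vertexE //=; [ring | lia].
  case: ltnP => x2n /=.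
    rewrite path_vertexE ?eqxx; last lia.
    by rewrite (_ : m.-1 == 0%N = false) ?subnKC //; [ring | lia].
  rewrite path_vertexE /=; last lia.
  rewrite (_ : _ == m.-1 = false); last lia.
  by rewrite (_ : 2 * n + _ - 1 = x)%N; [ring | lia].
rewrite xE pathx (sum_ancestors_ord _ (to_tree1_lt x)).
rewrite (@sum_ancestors_ord _ (fun z => F (n + z)%N) _ (to_tree2_lt x)).
rewrite !big_sumType /=; ring.
Qed.

(** In each copy a separating edge lies on one of two root paths of length at most h - 1; the path
    adds at most m - 1, for a total of 4 (h - 1) + m - 1. *)
Lemma cut_count x y : (x < N)%N -> (y < N)%N ->
  (\sum_i (cut i x != cut i y) <= 4 * h + m - 5)%N.
Proof.
move=> xN yN; rewrite !big_sumType /=.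
have tree s t : (s < n)%N -> (t < n)%N -> (\sum_(i < n.-1)
    (((i : nat) \in ancestors h.-1 s) != ((i : nat) \in ancestors h.-1 t)) <= 2 * h.-1)%N.
  move=> sn tn; apply: (@leq_trans (size (ancestors h.-1 s) + size (ancestors h.-1 t))).
    rewrite -!(@sum_mem_le n.-1) ?ancestors_uniq //; try by move=> i /ancestors_lt; lia.
    rewrite -big_split /=; apply: leq_sum => i _.
    by case: (_ \in ancestors _ s); case: (_ \in ancestors _ t).
  by rewrite mul2n -addnn leq_add ?size_ancestors.
have path : (\sum_(i < m.-1) ((i < to_path x)%N != (i < to_path y)%N) <= m.-1)%N.
  rewrite -[leqRHS]card_ord -sum1_card; apply: leq_sum => i _; exact: leq_b1.
apply: (@leq_trans (2 * h.-1 + 2 * h.-1 + m.-1)); last lia.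
by rewrite !leq_add ?tree ?to_tree1_lt ?to_tree2_lt.
Qed.

Lemma Tnm_poincare (R : realFieldType) (f : 'rV[R]_N) : \sum_i f 0 i = 0 ->
  4 * \sum_i f 0 i ^+ 2 <=
  (4 * h + m - 5)%N%:R * N%:R * qform (laplacian R (Tnm h m u v)) f.
Proof.
move=> f0; pose F x := if insub x is Some i then f 0 (i : 'I_N) else 0.
have FE (i : 'I_N) : F i = f 0 i by rewrite /F valK.
have [K KE] := cut_decomposition F.
pose a i := Ordinal (edge_head_lt i); pose b i := Ordinal (edge_tail_lt i).
apply: (@le_trans _ _ ((4 * h + m - 5)%N%:R * N%:R *
    \sum_i (F (edge_tail i) - F (edge_head i)) ^+ 2)).
  rewrite -[in X in _ <= _ * X * _](card_ord N).
  apply: (@cut_poincare R _ _ (fun i x => cut i (x : 'I_N))) f0 => [x|x y].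
    by rewrite -FE; exact: KE.
  exact: cut_count.
rewrite ler_wpM2l ?mulr_ge0 //.
under eq_bigr => i _ do rewrite (FE (a i)) (FE (b i)).
apply: energy_ge => [||i|]; [exact: Tnm_sym | exact: Tnm_irr | exact: edge_adj |].
move=> p q; case: p q => [i c] [j d] /=.
case: c d => [] [] /= [E1 E2].
- by rewrite (edge_ends_inj E1 E2).
- by case: (edge_not_reversed E1 E2).
- by case: (edge_not_reversed E2 E1).
- by rewrite (edge_ends_inj E2 E1).
Qed.

(** Every path vertex retracts to [u] in the first copy and to [v] in the second, so the test vector
    is constant along the path. *)
Lemma path_step_ends a b :
  has (fun k => (path_vertex k == a) && (path_vertex k.+1 == b) ||
                (path_vertex k == b) && (path_vertex k.+1 == a)) (iota 0 (m - 1)) ->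
  [&& to_tree1 a == u, to_tree1 b == u, to_tree2 a == v & to_tree2 b == v].
Proof.
have on_path k : (k < m)%N -> to_tree1 (path_vertex k) = u /\ to_tree2 (path_vertex k) = v.
  have lu := ltn_ord u; have lv := ltn_ord v.
  rewrite /to_tree1 /to_tree2 => /path_vertexP[] [].
  - by move=> _ ->; rewrite lu ifF //; lia.
  - by move=> _ ->; rewrite ifF ?ifT ?addKn //; lia.
  - by move=> k0 k1 ->; rewrite ifF ?ifF //; lia.
case/hasP => k; rewrite mem_iota => km.
have [km0 km1] : (k < m)%N /\ (k.+1 < m)%N by lia.
by case/orP => /andP[/eqP <- /eqP <-]; have [-> ->] := on_path k km0;
  have [-> ->] := on_path _ km1; rewrite !eqxx.
Qed.

(** * The test vector for the upper bound *)

Section TestVector.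
Variables (R : realFieldType) (c d : nat).
Hypotheses (c1 : (c <= 1)%N) (d1 : (d <= 1)%N).
Hypotheses (cu : c \notin ancestors h.-1 u) (dv : d \notin ancestors h.-1 v).

(** As the chosen subtree misses the attachment vertex, the predicate is false outside its own
    copy. *)
Let in_sub1 (x : nat) := c \in ancestors h.-1 (to_tree1 x).
Let in_sub2 (x : nat) := d \in ancestors h.-1 (to_tree2 x).

Definition test_vector : 'rV[R]_N := \row_x ((in_sub1 x)%:R - (in_sub2 x)%:R).

Lemma sum_subtree1 : (\sum_(x < N) (in_sub1 x : nat) = 2 ^ h.-1 - 1)%N.
Proof.
have n3 := tree_size_ge3.
rewrite -(big_mkord xpredT (fun x => in_sub1 x : nat)) (@big_cat_nat _ _ _ n) //=; last lia.
rewrite [X in (_ + X)%N]big_nat_cond [X in (_ + X)%N]big1 ?addn0; last first.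
  move=> x /andP[/andP[nx _] _]; rewrite /in_sub1 /to_tree1 ltnNge nx /=.
  by rewrite (negbTE cu).
rewrite big_mkord -(subtree_size _ c1) prednK; last lia.
by apply: eq_bigr => x _; rewrite /in_sub1 /to_tree1 ltn_ord.
Qed.

Lemma sum_subtree2 : (\sum_(x < N) (in_sub2 x : nat) = 2 ^ h.-1 - 1)%N.
Proof.
have n3 := tree_size_ge3.
rewrite -(big_mkord xpredT (fun x => in_sub2 x : nat)) (@big_cat_nat _ _ _ (2 * n)) //=; last lia.
rewrite [X in (_ + X)%N]big_nat_cond [X in (_ + X)%N]big1 ?addn0; last first.
  move=> x /andP[/andP[nx _] _]; rewrite /in_sub2 /to_tree2 ifF ?(negbTE dv) //.
  by apply/negbTE; lia.
rewrite (@big_cat_nat _ _ _ n) //=; last lia.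
rewrite [X in (X + _)%N]big_nat_cond [X in (X + _)%N]big1 ?add0n; last first.
  move=> x /andP[/andP[_ xn] _]; rewrite /in_sub2 /to_tree2 ifF ?(negbTE dv) //.
  by apply/negbTE; lia.
rewrite -{1}[n]add0n big_addn (_ : 2 * n - n = n)%N; last lia.
rewrite big_mkord -(subtree_size _ d1) prednK; last lia.
apply: eq_bigr => x _; rewrite /in_sub2 /to_tree2 addnK ifT //.
by have := ltn_ord x; rewrite -/n; lia.
Qed.

Lemma subtrees_disjoint x : ~~ (in_sub1 x && in_sub2 x).
Proof.
rewrite /in_sub1 /in_sub2 /to_tree1 /to_tree2; case: ifP => xn; last by rewrite (negbTE cu).
by rewrite ifF ?(negbTE dv) ?andbF //; lia.
Qed.

Lemma test_vector_sum : \sum_x test_vector 0 x = 0.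
Proof.
under eq_bigr => x _ do rewrite mxE.
by rewrite sumrB -!natr_sum sum_subtree1 sum_subtree2 subrr.
Qed.

Lemma test_vector_norm : \sum_x test_vector 0 x ^+ 2 = (n - 1)%N%:R.
Proof.
transitivity ((\sum_(x < N) (in_sub1 x : nat) + \sum_(x < N) (in_sub2 x : nat))%N%:R : R).
  rewrite natrD !natr_sum -big_split; apply: eq_bigr => x _; rewrite mxE /=.
  by have := subtrees_disjoint x; case: (in_sub1 x) (in_sub2 x) => [] [] //= _; ring.
rewrite sum_subtree1 sum_subtree2; congr _%:R.
have e : (2 ^ h = 2 * 2 ^ h.-1)%N by rewrite -expnS prednK //; lia.
have p : (0 < 2 ^ h.-1)%N by rewrite expn_gt0.
by rewrite /n e; lia.
Qed.

(** Only the edges from each root to its chosen child carry a nonzero increment, and each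
    contributes 1. *)
Lemma test_vector_energy : qform (laplacian R (Tnm h m u v)) test_vector <= 2.
Proof.
have n3 := tree_size_ge3.
rewrite -(@ler_pMn2r _ 2) // (qform_laplacian Tnm_sym Tnm_irr).
have h0 : (0 < N)%N by lia.
have hc : (c.+1 < N)%N by lia.
have hn : (n < N)%N by lia.
have hd : (n + d.+1 < N)%N by lia.
pose o0 := Ordinal h0; pose oc := Ordinal hc; pose on := Ordinal hn; pose od := Ordinal hd.
pose J (a b i j : 'I_N) : R := ((i == a) && (j == b))%:R.
have sumJ a b : \sum_i \sum_j J a b i j = 1.
  rewrite (bigD1 a) //= (bigD1 b) //= /J !eqxx big1 ?addr0; last first.
    by move=> j /negbTE ->.
  rewrite big1 ?addr0 // => i /negbTE ia; rewrite big1 // => j _.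
  by rewrite ia.
(* The doubled energy runs over ordered pairs: two edges in both orientations give 4, and the
   comparison is made termwise. *)
have -> : 2 *+ 2 = \sum_i \sum_j
    (J o0 oc i j + J oc o0 i j + (J on od i j + J od on i j)).
  transitivity ((\sum_i \sum_j J o0 oc i j + \sum_i \sum_j J oc o0 i j) +
    (\sum_i \sum_j J on od i j + \sum_i \sum_j J od on i j)).
    by rewrite !sumJ; ring.
  by rewrite -!big_split; apply: eq_bigr => i _; rewrite -!big_split.
apply: ler_sum => i _; apply: ler_sum => j _; rewrite !mxE.
have orb_ge1 (p q : bool) : p || q -> 1 <= p%:R + q%:R :> R.
  by rewrite -natrD ler1n; case: p q => [] [].
have J0 a b : 0 <= J a b i j by [].
have Jge0 : 0 <= J o0 oc i j + J oc o0 i j + (J on od i j + J od on i j).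
  by rewrite !addr_ge0.
case: (boolP (Tnm h m u v i j)); last by rewrite mul0r.
rewrite mul1r /Tnm Tnm_adjE => /or3P[/and3P[li lj adj]|/and3P[li lj adj]|].
- have -> : in_sub2 i = false by rewrite /in_sub2 /to_tree2 ifF ?(negbTE dv) //; lia.
  have -> : in_sub2 j = false by rewrite /in_sub2 /to_tree2 ifF ?(negbTE dv) //; lia.
  rewrite !subr0; have [->|ne] := eqVneq (in_sub1 j) (in_sub1 i).
    by rewrite subrr expr0n.
  have : J o0 oc i j + J oc o0 i j >= 1.
    have := @subtree_edge c i j c1 li lj adj.
    move: ne; rewrite eq_sym /in_sub1 /to_tree1 li lj => -> /(_ isT).
    case/orP => /andP[/eqP e1 /eqP e2]; apply: orb_ge1; rewrite -!val_eqE /=.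
      by rewrite e1 e2 !eqxx.
    by rewrite e1 e2 !eqxx orbT.
  move=> J1; apply: le_trans (_ : 1 <= _).
    by case: (in_sub1 i) (in_sub1 j) => [] [] /=; lra.
  by apply: le_trans J1 _; rewrite lerDl addr_ge0.
- have -> : in_sub1 i = false.
    by rewrite /in_sub1 /to_tree1 ifF ?(negbTE cu) //; lia.
  have -> : in_sub1 j = false.
    by rewrite /in_sub1 /to_tree1 ifF ?(negbTE cu) //; lia.
  rewrite !sub0r; have [->|ne] := eqVneq (in_sub2 j) (in_sub2 i).
    by rewrite subrr expr0n.
  have : J on od i j + J od on i j >= 1.
    have := @subtree_edge d (i - n)%N (j - n)%N d1 _ _ adj.
    move: ne; rewrite eq_sym /in_sub2 /to_tree2 li lj => -> /(_ ltac:(lia) ltac:(lia) isT).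
    have shift (k : 'I_N) y : (n <= k < 2 * n)%N -> (k - n)%N = y -> (k : nat) = (n + y)%N.
      by lia.
    case/orP => /andP[/eqP e1 /eqP e2]; apply: orb_ge1; rewrite -!val_eqE /=.
      by rewrite (shift _ _ li e1) (shift _ _ lj e2) addn0 !eqxx.
    by rewrite (shift _ _ lj e1) (shift _ _ li e2) addn0 !eqxx orbT.
  move=> J1; apply: le_trans (_ : 1 <= _).
    by case: (in_sub2 i) (in_sub2 j) => [] [] /=; lra.
  by apply: le_trans J1 _; rewrite lerDr addr_ge0.
- move=> /path_step_ends /and4P[/eqP i1 /eqP j1 /eqP i2 /eqP j2].
  by rewrite /in_sub1 /in_sub2 i1 j1 i2 j2 subrr expr0n.
Qed.

End TestVector.

End Tnm.

Unset Implicit Arguments.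

(* The eigenvalues of L(T_n^m), listed in nondecreasing order with multiplicity,
   are the sorted sequence s with char_poly L = prod_(x <- s) (X - x);
   lambda_2 is s`_1.  Here log2(n+1) = h. *)
Theorem theorem6p1 (R : realType) (h m : nat) (u v : 'I_(2 ^ h - 1)) :
  (2 <= h)%N -> (2 <= m)%N ->
  let n := (2 ^ h - 1)%N in
  exists s : seq R,
    [/\ sorted <=%R s,
        char_poly (laplacian R (Tnm h m u v)) = \prod_(x <- s) ('X - x%:P),
        2 / (((2 * n + m - 1)%N)%:R * ((2 * h + m - 3)%N)%:R) <= s`_1
      & s`_1 <= 5 / (2 * (n - 1)%N%:R)].
Proof.
move=> h2 m2 n.
have n3 : (3 <= n)%N := tree_size_ge3 h2.
have [c c1 cu] := exists_free_subtree h.-1 u.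
have [d d1 dv] := exists_free_subtree h.-1 v.
set N := (2 * n + m - 2)%N; pose w : 'rV[R]_N := const_mx 1.
have wE (f : 'rV[R]_N) : f *m w^T = 0 <-> \sum_i f 0 i = 0.
  have fw : (f *m w^T) 0 0 = \sum_i f 0 i.
    by rewrite mxE; apply: eq_bigr => i _; rewrite !mxE mulr1.
  split=> [fw0|f0]; first by rewrite -fw fw0 mxE.
  by apply/matrixP => i j; rewrite !ord1 fw f0 mxE.
have g_norm := test_vector_norm h2 m2 R c1 d1 cu dv.
have Npos : (0 < N)%N by rewrite /N; lia.
have n1 : (0 : R) < (n - 1)%N%:R by rewrite ltr0n; lia.
apply: (@second_eigenvalue_bounds R N _ w (@test_vector h m u v R c d)).
- by apply: tr_laplacian; [exact: Tnm_sym | exact: Tnm_irr].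
- by apply: const_mul_laplacian; [exact: Tnm_sym | exact: Tnm_irr].
- by apply/wE; exact: test_vector_sum.
- apply/eqP => /rowP /(_ (Ordinal Npos)); rewrite !mxE => /eqP.
  by rewrite oner_eq0.
- apply/eqP => g0; move: g_norm; rewrite g0 big1 => [e|i _].
    by move: n1; rewrite -e ltxx.
  by rewrite mxE expr0n.
- by rewrite divr_ge0 ?mulr_ge0 // ltW.
- move=> f /wE f0; have := Tnm_poincare h2 u v m2 f0.
  rewrite qform1E -/n -/N; set S := \sum_i f 0 i ^+ 2; set Q := qform _ f => SQ.
  have S0 : 0 <= S by apply: sumr_ge0 => i _; exact: sqr_ge0.
  have Dp : (0 : R) < (2 * h + m - 3)%N%:R by rewrite ltr0n; lia.
  have Np : (0 : R) < (2 * n + m - 1)%N%:R by rewrite ltr0n; lia.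
  (* Here 4h + m - 5 is at most 2 (2h + m - 3) and [N] is below 2n + m - 1, so 4 / (D N) is at least
     the stated bound. *)
  have DN : (4 * h + m - 5)%N%:R * N%:R <=
      2 * ((2 * n + m - 1)%N%:R * (2 * h + m - 3)%N%:R) :> R.
    by rewrite -!natrM ler_nat /N; nia.
  (* Nonnegativity of the energy is read off from [SQ], whose left side is a sum of squares. *)
  have Q0 : 0 <= Q.
    rewrite -(@pmulr_rge0 _ ((4 * h + m - 5)%N%:R * N%:R)).
      by apply: le_trans SQ; rewrite mulr_ge0.
    by rewrite -natrM ltr0n muln_gt0 Npos andbT; lia.
  rewrite mulrAC ler_pdivrMr ?mulr_gt0 // [Q * _]mulrC.
  by have := ler_wpM2r Q0 DN; lra.
(* The Rayleigh quotient is at most 2 / (n - 1), and 2 is below 5 / 2. *)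
- apply: le_trans (test_vector_energy h2 m2 R c1 d1 cu dv) _.
  rewrite qform1E g_norm invfM mulrA mulfVK ?gt_eqF //.
  by rewrite ler_pdivlMr //; lra.
Qed.
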